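(* Let $\mu\in C(P,\mathbb{R})$ have compact support $P_\mu\subset P$ with $P_\mu\cap P_\gamma\neq\emptyset$. Then there exist constants $\Gamma_{1_+}\le\Gamma_{2_+}$ and $\Gamma_{2_-}\le\Gamma_{1_-}$ such that for every initial interface $I_0\in\mathcal{I}_\gamma$, every real sequence $(w_k)_{k\in\mathbb{Z}_+}$ of pulse amplitudes and every $k\in\mathbb{Z}_+$, the remnant difference $\Delta_k\gamma=\gamma(w_{k+1},I_{k+1})-\gamma(w_k,I_k)$ and $\Delta_k w=w_{k+1}-w_k$ satisfy $$\Gamma_{1_+}\Delta_k w\le\Delta_k\gamma\le\Gamma_{2_+}\Delta_k w\quad\text{if }\Delta_k w>0,$$ $$\Gamma_{1_-}\Delta_k w\le\Delta_k\gamma\le\Gamma_{2_-}\Delta_k w\quad\text{if }\Delta_k w<0.$$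
   Context: Preisach plane: $P=\{(\alpha,\beta)\in\mathbb{R}^2: \alpha\ge\beta\}$, and $P_\gamma=\{(\alpha,\beta)\in P:\alpha\ge 0,\ \beta\le 0\}$. Interfaces: $\mathcal{I}$ is the set of interfaces, i.e. monotonically decreasing staircase lines $L=\{\ell(c): c\in\mathbb{R}_+\}\subset P$ given by a continuous curve $\ell:\mathbb{R}_+\to P$ with $\ell(0)=(b,b)$ for some $b\in\mathbb{R}$ and $\lim_{c\to\infty}\|\ell(c)\|=\infty$. Monotonically decreasing means: for $(\alpha_1,\beta_1),(\alpha_2,\beta_2)\in L$, $\beta_1>\beta_2$ implies $\alpha_1\le\alpha_2$. $\mathcal{I}_\gamma=\{L\in\mathcal{I}:(0,0)\in L\}$; each such $L$ lies in $P_\gamma$. Relays: for $L_0\in\mathcal{I}$ let $r_{\alpha,\beta}(L_0)=1$ if $L_0\cap\{(\alpha_1,\beta_1):\alpha<\alpha_1,\ \beta<\beta_1\}\ne\emptyset$ (the point $(\alpha,\beta)$ is below $L_0$) and $-1$ otherwise. For an absolutely continuous input $u$ with $(u(0),u(0))\in L_0$, the relay $(\mathcal{R}_{\alpha,\beta}(u,L_0))(t)$ equals $1$ if $u(t)>\alpha$, equals $-1$ if $u(t)<\beta$, and if $\beta\le u(t)\le\alpha$ it keeps its previous state $(\mathcal{R}_{\alpha,\beta}(u,L_0))(t_-)$ when $t>0$ and equals $r_{\alpha,\beta}(L_0)$ when $t=0$. (So when $\beta\le u(t)\le\alpha$, the relay has the value it had when $u$ was most recently outside $[\beta,\alpha]$,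 or $r_{\alpha,\beta}(L_0)$ if $u$ has stayed in $[\beta,\alpha]$ on $[0,t]$.) Preisach operator with weighting function $\mu$: $(\mathcal{P}(u,L_0))(t)=\iint_{P}\mu(\alpha,\beta)\,(\mathcal{R}_{\alpha,\beta}(u,L_0))(t)\,d\alpha\,d\beta$. Pulses and remnant: fix $\tau>0$. Let $v_0$ be the unit triangular pulse: $v_0(t)=\frac{2}{\tau}t$ on $[0,\tau/2]$, $v_0(t)=\frac{2}{\tau}(\tau-t)$ on $(\tau/2,\tau]$, and $0$ otherwise. For $w\in\mathbb{R}$ and $I\in\mathcal{I}_\gamma$, the remnant is $\gamma(w,I)=(\mathcal{P}(wv_0,I))(\tau)$. Given $I_0\in\mathcal{I}_\gamma$ and a real sequence $(w_k)_{k\ge 0}$, the input $u_\gamma(t)=\sum_{k\ge0}w_kv_0(t-k\tau)$ is applied starting from $I_0$, and $I_k\in\mathcal{I}_\gamma$ is the interface describing the relay states at time $k\tau$; equivalently, $I_{k+1}\in\mathcal{I}_\gamma$ is the interface such that $r_{\alpha,\beta}(I_{k+1})=(\mathcal{R}_{\alpha,\beta}(w_kv_0,I_k))(\tau)$ for almost every $(\alpha,\beta)\in P$. *)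

(* Defs.v *)
From HB Require Import structures.
From mathcomp Require Import all_boot all_order all_algebra.
From mathcomp Require Import all_classical all_reals all_analysis.

Set Implicit Arguments.
Unset Strict Implicit.
Unset Printing Implicit Defensive.

Import Order.TTheory GRing.Theory Num.Theory.
Import numFieldNormedType.Exports.

Local Open Scope classical_set_scope.
Local Open Scope ring_scope.

(* A point of the plane is a pair p = (alpha, beta): p.1 is the upper
   threshold of the relay and p.2 the lower one. *)

Definition preisach_plane {R : realType} : set (R * R) :=
  [set p | p.2 <= p.1].

Definition preisach_plane_gamma {R : realType} : set (R * R) :=
  [set p | [/\ preisach_plane p, 0 <= p.1 & p.2 <= 0]].

Definition decreasing_line {R : realType} (L : set (R * R)) : Prop :=
  forall p q : R * R, L p -> L q -> q.2 < p.2 -> p.1 <= q.1.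

(* The curve l is only relevant on [0, +oo[.  The norm of R * R is the max
   norm, which tends to +oo exactly when the Euclidean norm does. *)
Definition interface {R : realType} (L : set (R * R)) : Prop :=
  [/\ L `<=` preisach_plane,
      decreasing_line L &
      exists l : R -> R * R,
        [/\ {within `[0, +oo[, continuous l},
            L = l @` `[0, +oo[,
            exists b : R, l 0 = (b, b) &
            `|l c| @[c --> +oo] --> +oo]].

Definition interface_gamma {R : realType} (L : set (R * R)) : Prop :=
  interface L /\ L (0, 0).

Definition relay_init {R : realType} (p : R * R) (L0 : set (R * R)) : R :=
  if `[< L0 `&` [set q | p.1 < q.1 /\ p.2 < q.2] !=set0 >] then 1 else -1.

(* When p.2 <= u t <= p.1, the previous state is the initial one if u has
   stayed in [p.2, p.1] on [0, t]; otherwise it is 1 or -1 according to the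
   side on which u was most recently outside [p.2, p.1], i.e. it is 1 when u
   exceeded p.1 at some time s and has not been smaller than p.2 since. *)
Definition relay {R : realType} (p : R * R) (u : R -> R) (L0 : set (R * R))
    (t : R) : R :=
  if p.1 < u t then 1
  else if u t < p.2 then -1
  else if `[< forall s, 0 <= s <= t -> p.2 <= u s <= p.1 >]
       then relay_init p L0
  else if `[< exists s, [/\ 0 <= s <= t, p.1 < u s &
                            forall s', s <= s' <= t -> p.2 <= u s'] >]
       then 1 else -1.

Notation area R := (@lebesgue_measure R \x @lebesgue_measure R)%E.

Definition preisach {R : realType} (mu : R * R -> R) (u : R -> R)
    (L0 : set (R * R)) (t : R) : R :=
  \int[area R]_(p in preisach_plane) (mu p * relay p u L0 t).

Definition unit_pulse {R : realType} (tau t : R) : R :=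
  if 0 <= t <= tau / 2 then 2 / tau * t
  else if tau / 2 < t <= tau then 2 / tau * (tau - t)
  else 0.

Definition remnant {R : realType} (tau : R) (mu : R * R -> R) (w : R)
    (I : set (R * R)) : R :=
  preisach mu (fun t => w * unit_pulse tau t) I tau.

Definition interface_sequence {R : realType} (tau : R) (w : nat -> R)
    (I0 : set (R * R)) (I : nat -> set (R * R)) : Prop :=
  I 0%N = I0 /\
  forall k : nat,
    interface_gamma (I k.+1) /\
    {ae area R, forall p : R * R, preisach_plane p ->
      relay_init p (I k.+1) =
      relay p (fun t => w k * unit_pulse tau t) (I k) tau}.

(* Only the values of mu on the Preisach plane matter; that plane is closed,
   so this is the support of the restriction of mu to it. *)
Definition preisach_support {R : realType} (mu : R * R -> R) : set (R * R) :=
  closure [set p | preisach_plane p /\ mu p != 0].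

(* Main.v *)
(* A relay whose thresholds straddle 0 ends a pulse of amplitude w at 1 if its
   upper threshold is below w, at -1 if its lower threshold is above w, and is
   unchanged otherwise.  Hence the pulse w_(k+1) applied after the pulse w_k only
   switches relays with one threshold between w_k and w_(k+1).  Within the
   bounded support of mu these occupy an area O(|w_(k+1) - w_k|), and mu is
   bounded, so |Delta gamma| <= C |Delta w|. *)

Require Import Defs.
From HB Require Import structures.
From mathcomp Require Import all_boot all_order all_algebra.
From mathcomp Require Import all_classical all_reals all_analysis.
From mathcomp Require Import measurable_realfun ring lra.

Set Implicit Arguments.
Unset Strict Implicit.
Unset Printing Implicit Defensive.

Import Order.TTheory GRing.Theory Num.Theory.
Import numFieldNormedType.Exports.
Local Open Scope classical_set_scope.
Local Open Scope ring_scope.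

(** * Borel measurability in the plane *)

Lemma open_measurable_plane (R : realType) (U : set (R * R)) :
  open U -> measurable U.
Proof.
move=> oU.
(* Products of balls with rational centres and radii form a countable base of the plane, and each of
   them is a measurable rectangle. *)
pose rect (q : (rat * rat) * (rat * rat)) : set (R * R) :=
  (ball (ratr q.1.1 : R) (ratr q.1.2)) `*` (ball (ratr q.2.1 : R) (ratr q.2.2)).
have -> : U = \bigcup_(q in [set q | rect q `<=` U]) rect q.
  apply/seteqP; split=> [p Up|p [q /= qU /qU//]].
  have : nbhs p U by exact: open_nbhs_nbhs.
  case=> -[V W] /= [nV nW] VWU.
  have [c1 [r1 [/set_mem p1 B1]]] := open_subball_rat (open_interior V) (mem_set nV).
  have [c2 [r2 [/set_mem p2 B2]]] := open_subball_rat (open_interior W) (mem_set nW).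
  exists ((c1, r1), (c2, r2)) => // z [/B1 z1 /B2 z2].
  by apply: VWU; split; exact: interior_subset.
rewrite bigcup_mkcond; apply: countable_bigcupT_measurable => // q.
case: ifP => // _; apply: measurableX; rewrite ball_itv; exact: measurable_itv.
Qed.

Lemma subspace_continuous_measurable_fun_plane (R : realType) (D : set (R * R))
    (f : R * R -> R) :
  measurable D -> {within D, continuous f} -> measurable_fun D f.
Proof.
move=> mD /continuousP cf.
apply: (measurability _ (RGenOpens.measurableE R)).
move=> _ [_ [a [b ->] <-]].
have /open_subspaceP[V oV VD] : open (from_subspace D f @^-1` `]a, b[).
  exact/cf/interval_open.
rewrite setIC -VD; apply: measurableI => //; exact: open_measurable_plane.
Qed.

Lemma closed_preisach_plane (R : realType) : closed (@preisach_plane R).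
Proof.
have -> : preisach_plane = (fun p : R * R => p.1 - p.2) @^-1` [set x | 0 <= x].
  by apply/seteqP; split=> p; rewrite /preisach_plane/= subr_ge0.
apply: closed_comp; last exact: closed_ge.
by move=> p _; apply: cvgB; [exact: cvg_fst|exact: cvg_snd].
Qed.

Lemma measurable_preisach_plane (R : realType) : measurable (@preisach_plane R).
Proof.
rewrite -(setCK preisach_plane); apply: measurableC.
by apply: open_measurable_plane; exact/closed_openC/closed_preisach_plane.
Qed.

(** * Integrals of functions dominated by a multiple of an indicator *)

Section indicator_bound.
Context (d : measure_display) (T : measurableType d) (R : realType).
Context (m : {measure set T -> \bar R}) (D S : set T) (f : T -> R) (c s : R).
Hypotheses (mD : measurable D) (mS : measurable S) (mf : measurable_fun D f).
Hypotheses (c0 : 0 <= c) (mSs : (m S <= s%:E)%E).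
Hypothesis fS : {ae m, forall x, D x -> `|f x| <= c * \1_S x}.

Lemma integral_abse_le_indic : (\int[m]_(x in D) `|(f x)%:E| <= (c * s)%:E)%E.
Proof.
apply: (@le_trans _ _ (\int[m]_(x in D) (c%:E * (\1_S x)%:E))%E).
  apply: ae_ge0_le_integral => //.
  - by apply: measurableT_comp => //; exact/measurable_EFinP.
  - by move=> x _; rewrite -EFinM lee_fin mulr_ge0.
  - by apply/measurable_EFinP/measurable_funM => //; exact: measurable_indic.
rewrite ge0_integralZl//.
  2: by apply/measurable_EFinP; exact: measurable_indic.
rewrite integral_indic// EFinM; apply: lee_wpmul2l; first by rewrite lee_fin.
by apply: le_trans mSs; apply: le_measure; rewrite ?inE//; exact: measurableI.
Qed.

Lemma integrable_le_indic : m.-integrable D (EFin \o f).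
Proof.
apply/integrableP; split; first exact/measurable_EFinP.
by apply: le_lt_trans integral_abse_le_indic _; rewrite ltry.
Qed.

Lemma normr_Rintegral_le_indic : `|\int[m]_(x in D) f x| <= c * s.
Proof.
rewrite -lee_fin EFin_normr_Rintegral//; last exact: integrable_le_indic.
apply: le_trans integral_abse_le_indic.
by apply: le_abse_integral => //; exact/measurable_EFinP.
Qed.

End indicator_bound.

(** * Relay states before and after a pulse *)

Lemma normr_relay_init_le1 (R : realType) (p : R * R) (L : set (R * R)) :
  `|relay_init p L : R| <= 1.
Proof. by rewrite /relay_init; case: ifP => _; rewrite ?normrN ?normr1. Qed.

(** The points below [L] form a union of open quadrants with corners in [L], hence an open set,
    however irregular [L] is. *)
Lemma measurable_relay_init (R : realType) (L : set (R * R)) (D : set (R * R)) :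
  measurable_fun D (fun p => relay_init p L).
Proof.
rewrite /relay_init.
suff mL : measurable [set p : R * R |
    L `&` [set q | p.1 < q.1 /\ p.2 < q.2] !=set0].
  apply: (measurable_funS measurableT) => //.
  apply: measurable_fun_ifT => //.
  apply: (measurable_fun_bool true); rewrite setTI.
  rewrite (_ : _ @^-1` _ = [set p : R * R |
    L `&` [set q | p.1 < q.1 /\ p.2 < q.2] !=set0])//.
  by apply/seteqP; split=> p /= /asboolP.
apply: open_measurable_plane.
rewrite (_ : mkset _ = \bigcup_(q in L) [set p | p.1 < q.1 /\ p.2 < q.2]).
  apply: bigcup_open => q _.
  have -> : [set p : R * R | p.1 < q.1 /\ p.2 < q.2] =
     fst @^-1` [set x | x < q.1] `&` snd @^-1` [set x | x < q.2] by [].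
  apply: openI.
    apply: open_comp; last exact: open_lt.
    by move=> *; exact: cvg_fst.
  apply: open_comp; last exact: open_lt.
  by move=> *; exact: cvg_snd.
apply/seteqP; split=> [p [q [Lq pq]]|p [q Lq pq]]; by exists q.
Qed.

Lemma unit_pulse_ge0_le1 (R : realType) (tau t : R) :
  0 < tau -> 0 <= unit_pulse tau t <= 1.
Proof.
move=> tau0; rewrite /unit_pulse.
have tauK : 2 / tau * (tau / 2) = 1 by field; rewrite gt_eqF.
have k0 : 0 <= 2 / tau by rewrite divr_ge0// ltW.
case: ifP => [/andP[t0 t1]|_].
  by rewrite mulr_ge0//= -[leRHS]tauK ler_wpM2l.
case: ifP => [/andP[t0 t1]|_]; last by rewrite lexx ler01.
rewrite mulr_ge0 ?subr_ge0//= -[leRHS]tauK ler_wpM2l//; lra.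
Qed.

Lemma unit_pulse_mid (R : realType) (tau : R) :
  0 < tau -> unit_pulse tau (tau / 2) = 1.
Proof.
move=> tau0; rewrite /unit_pulse lexx andbT divr_ge0 ?ltW//.
by field; rewrite gt_eqF.
Qed.

Lemma unit_pulse_end (R : realType) (tau : R) :
  0 < tau -> unit_pulse tau tau = 0.
Proof.
move=> tau0; rewrite /unit_pulse; case: ifP => [/andP[_ ?]|_]; first by lra.
by case: ifP => // _; rewrite subrr mulr0.
Qed.

(** The first two cases are relays forced by the zero input at the end of the pulse. Taking a state
    [c] instead of an interface lets two successive pulses be composed. *)
Definition pulse_state (R : realType) (p : R * R) (w c : R) : R :=
  if p.1 < 0 then 1 else if 0 < p.2 then -1
  else if p.1 < w then 1 else if w < p.2 then -1 else c.

(** The input stays between 0 and [w], equals [w] at [tau / 2] and ends at 0. For a relay straddling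
    0, a peak beyond one threshold sets the state, and the input, being of constant sign, never
    crosses the other threshold. Otherwise the input never leaves the band. *)
Lemma relay_pulse (R : realType) (tau w : R) (p : R * R) (L : set (R * R)) :
  0 < tau -> preisach_plane p ->
  relay p (fun t => w * unit_pulse tau t) L tau =
  pulse_state p w (relay_init p L).
Proof.
move=> tau0 pP; rewrite /pulse_state /relay unit_pulse_end// mulr0.
case: ltP => // p10; case: ltP => // p20.
have mid : 0 <= tau / 2 <= tau by lra.
case: ltP => [p1w|wp1].
  rewrite asboolF; last first.
    by move/(_ _ mid); rewrite unit_pulse_mid// mulr1 => /andP[_]; rewrite leNgt p1w.
  rewrite asboolT//; exists (tau / 2); split=> //.
    by rewrite unit_pulse_mid// mulr1.
  move=> s _; have /andP[v0 _] := unit_pulse_ge0_le1 s tau0.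
  by rewrite (le_trans p20)// mulr_ge0// (le_trans p10)// ltW.
case: ltP => [wp2|p2w].
  rewrite asboolF; last first.
    by move/(_ _ mid); rewrite unit_pulse_mid// mulr1 => /andP[]; rewrite leNgt wp2.
  rewrite asboolF// => -[s [_ + _]].
  have /andP[v0 _] := unit_pulse_ge0_le1 s tau0.
  apply/negP; rewrite -leNgt (le_trans _ p10)// mulr_le0_ge0//.
  by rewrite (le_trans (ltW wp2)).
rewrite asboolT// => s _; have /andP[v0 v1] := unit_pulse_ge0_le1 s tau0.
by apply/andP; split; nra.
Qed.

Lemma normr_pulse_state_le1 (R : realType) (p : R * R) (w c : R) :
  `|c| <= 1 -> `|pulse_state p w c| <= 1.
Proof.
by rewrite /pulse_state; do 4?case: ifP => _ //; rewrite ?normrN ?normr1.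
Qed.

Lemma measurable_pulse_state (R : realType) (w : R) (D : set (R * R))
    (c : R * R -> R) :
  measurable_fun setT c ->
  measurable_fun D (fun p => pulse_state p w (c p)).
Proof.
move=> mc; apply: (measurable_funS measurableT) => //.
rewrite /pulse_state.
by do 4![apply: measurable_fun_ifT => //; first exact: measurable_fun_ltr].
Qed.

(** If both pulses pass the same threshold, the first has already set the state. If [w] passes the
    upper one and [w'] the lower one, [p.2 <= p.1 < w] still places [p.2] between the amplitudes. *)
Lemma pulse_state_neq (R : realType) (p : R * R) (w w' c : R) :
  preisach_plane p ->
  pulse_state p w' (pulse_state p w c) != pulse_state p w c ->
  (w <= p.1 <= w') || (w' <= p.2 <= w).
Proof.
rewrite /pulse_state /preisach_plane/= => pP.
case: (ltP p.1 0) => p1; first by rewrite eqxx.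
case: (ltP 0 p.2) => p2; first by rewrite eqxx.
case: (ltP p.1 w') => p1w'.
  case: (ltP p.1 w) => p1w; first by rewrite eqxx.
  by rewrite (ltW p1w').
case: (ltP w' p.2) => p2w'; last by rewrite eqxx.
case: (ltP p.1 w) => p1w.
  by rewrite (ltW p2w') orbC/= (le_trans pP)// ltW.
case: (ltP w p.2) => p2w; first by rewrite eqxx.
by rewrite (ltW p2w') orbT.
Qed.

(** * Strips of thresholds and bounds on the weighting function *)

Lemma area_rectangle (R : realType) (a b c d : R) : a <= b -> c <= d ->
  area R (`[a, b] `*` `[c, d]) = ((b - a) * (d - c))%:E.
Proof.
have E (x y : R) : x <= y -> lebesgue_measure `[x, y] = (y - x)%:E.
  move=> xy; rewrite lebesgue_measure_itv/= lte_fin.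
  by case: ltP => // yx; rewrite (@le_anti _ _ x y) ?xy// subrr.
move=> ab cd; rewrite product_measure1E; [|exact: measurable_itv..].
by rewrite EFinM; congr (_ * _)%E; exact: E.
Qed.

(** For [a], [b] the two successive amplitudes in increasing order, this contains every relay of the
    support that the second pulse switches. For [a = - M], [b = M] it is the whole square. *)
Definition strips (R : realType) (a b M : R) : set (R * R) :=
  (`[a, b] `*` `[- M, M]) `|` (`[- M, M] `*` `[a, b]).

Lemma measurable_strips (R : realType) (a b M : R) : measurable (strips a b M).
Proof.
by apply: measurableU; apply: measurableX; exact: measurable_itv.
Qed.

Lemma area_strips (R : realType) (a b M : R) : a <= b -> 0 <= M ->
  (area R (strips a b M) <= (4 * M * (b - a))%:E)%E.
Proof.
move=> ab M0; have NM : - M <= M by lra.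
have -> : 4 * M * (b - a) = (b - a) * (M - - M) + (M - - M) * (b - a) by ring.
rewrite EFinD -!area_rectangle//; apply: measureU2;
  by apply: measurableX; exact: measurable_itv.
Qed.

Lemma preisach_support_bound (R : realType) (mu : R * R -> R) :
  {within preisach_plane, continuous mu} -> compact (preisach_support mu) ->
  exists M K : R, [/\ 0 <= M, 0 <= K,
    (forall p, preisach_plane p -> `|mu p| <= K) &
    (forall p, preisach_plane p -> mu p != 0 -> -M <= p.1 <= M /\ -M <= p.2 <= M)].
Proof.
move=> muc sc.
have sP : preisach_support mu `<=` preisach_plane.
  move=> p; rewrite /preisach_support => sp.
  rewrite (_ : preisach_plane = closure preisach_plane); last first.
    by apply/closure_id; exact: closed_preisach_plane.
  by apply: closure_subset sp => q [].
have /compact_bounded[K0 [K0r /(_ (`|K0| + 1)) HK]] :=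
  continuous_compact (continuous_subspaceW sP muc) sc.
have /compact_bounded[M0 [M0r /(_ (`|M0| + 1)) HM]] := sc.
(* Compactness yields a bound by every number strictly above [K0] or [M0]; these choices are also
   nonnegative. *)
have lt1 (x : R) : x < `|x| + 1 by rewrite (le_lt_trans (ler_norm x))// ltrDl.
exists (`|M0| + 1), (`|K0| + 1); split; rewrite ?addr_ge0//.
  move=> p pP; have [->|mp] := eqVneq (mu p) 0; first by rewrite normr0 addr_ge0.
  by apply: HK => //; exists p => //; apply: subset_closure; split.
move=> p pP mp.
have : `|p| <= `|M0| + 1 by apply: HM => //; apply: subset_closure; split.
by rewrite /Num.norm/= ge_max => /andP[]; rewrite !ler_norml.
Qed.

(** * The remnant as an integral, and its increments *)

Lemma measurable_mul_pulse_state (R : realType) (mu : R * R -> R) (w : R)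
    (L : set (R * R)) :
  {within preisach_plane, continuous mu} ->
  measurable_fun preisach_plane
    (fun p => mu p * pulse_state p w (relay_init p L)).
Proof.
move=> muc; apply: measurable_funM; last first.
  by apply: measurable_pulse_state; exact: measurable_relay_init.
by apply: subspace_continuous_measurable_fun_plane => //;
  exact: measurable_preisach_plane.
Qed.

Lemma remnantE (R : realType) (tau : R) (mu : R * R -> R) (w : R)
    (L : set (R * R)) :
  0 < tau -> remnant tau mu w L =
  \int[area R]_(p in preisach_plane) (mu p * pulse_state p w (relay_init p L)).
Proof.
by move=> tau0; apply: eq_Rintegral => p /set_mem pP; rewrite relay_pulse.
Qed.

Theorem proposition3p2 (R : realType) (tau : R) (htau : 0 < tau)
    (mu : R * R -> R)
    (mu_cont : {within preisach_plane, continuous mu})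
    (mu_compact : compact (preisach_support mu))
    (mu_gamma : preisach_support mu `&` preisach_plane_gamma !=set0) :
  exists Gamma1p Gamma2p Gamma1m Gamma2m : R,
    [/\ Gamma1p <= Gamma2p, Gamma2m <= Gamma1m &
    forall I0 : set (R * R), interface_gamma I0 ->
    forall (w : nat -> R) (I : nat -> set (R * R)),
    interface_sequence tau w I0 I ->
    forall k : nat,
      let Dgamma := remnant tau mu (w k.+1) (I k.+1)
                    - remnant tau mu (w k) (I k) in
      let Dw := w k.+1 - w k in
      (0 < Dw -> Gamma1p * Dw <= Dgamma <= Gamma2p * Dw) /\
      (Dw < 0 -> Gamma1m * Dw <= Dgamma <= Gamma2m * Dw)].

Proof.
have [M [K [M0 K0 muK muM]]] := preisach_support_bound mu_cont mu_compact.
(* A switching relay changes the integrand by at most [2 * K], and the strips have area at most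
   [4 * M] times the amplitude difference. *)
pose C := 2 * K * (4 * M).
have C0 : 0 <= C by rewrite /C !mulr_ge0.
(* The signs swap for the last two constants because they multiply a negative [Dw]. *)
exists (- C), C, C, (- C); split; [lra..|].
move=> I0 _ w I [_ II] k Dg Dw.
suff : `|Dg| <= C * `|Dw|.
  rewrite ler_norml mulNr => H; split=> D0; move: H.
    by rewrite gtr0_norm.
  by rewrite ltr0_norm// mulrN opprK.
have [_ Iae] := II k.
pose F j p := mu p * pulse_state p (w j) (relay_init p (I j)).
have mP := @measurable_preisach_plane R.
have mF j : measurable_fun preisach_plane (F j).
  exact: measurable_mul_pulse_state.
have intF j : (area R).-integrable preisach_plane (EFin \o F j).
  have NM : - M <= M by lra.
  (* Explicit arguments: the factors of [area R] live on [measurableTypeR R],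
     which unification does not identify with [R]. *)
  apply: (@integrable_le_indic _ _ R (area R) preisach_plane
    (strips (- M) M M) (F j) K _ mP (measurable_strips (- M) M M) (mF j) K0
    (area_strips NM M0)).
  apply: aeW => p pP; rewrite /F normrM.
  have [->|mp] := eqVneq (mu p) 0; first by rewrite normr0 mul0r mulr_ge0.
  have [p1 p2] := muM _ pP mp.
  rewrite indicE mem_set; last by left; split; rewrite /= in_itv.
  by rewrite ler_pM// ?muK// normr_pulse_state_le1// normr_relay_init_le1.
rewrite /Dg !remnantE// -RintegralB;
  [|exact: mP|exact: (intF k.+1)|exact: (intF k)].
pose a := Order.min (w k) (w k.+1); pose b := Order.max (w k) (w k.+1).
have ab : a <= b by rewrite /a /b ge_min le_max lexx.
have bDa : b - a = `|Dw|.
  by rewrite /a /b /Dw; case: ltP => h; [rewrite gtr0_norm ?subr_gt0|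
    rewrite ler0_norm ?subr_le0// opprB].
rewrite /C -mulrA -bDa.
have mFB : measurable_fun preisach_plane (fun p => F k.+1 p - F k p).
  exact: measurable_funB.
have K20 : 0 <= 2 * K by rewrite mulr_ge0.
apply: (@normr_Rintegral_le_indic _ _ R (area R) preisach_plane
  (strips a b M) (fun p => F k.+1 p - F k p) (2 * K) (4 * M * (b - a))
  mP (measurable_strips a b M) mFB K20 (area_strips ab M0)).
(* [I k.+1] records the states left by pulse [k] only up to a null set, so the pointwise bound is
   proved off that set. *)
apply: negligibleS Iae => p; apply: contra_not => Ip pP; move: Ip => /(_ pP) Ip.
rewrite -mulrBr normrM.
have [->|mp] := eqVneq (mu p) 0; first by rewrite normr0 mul0r !mulr_ge0.
have [p1 p2] := muM _ pP mp.
(* The difference becomes the change that pulse [k.+1] makes to the state left by pulse [k]. *)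
rewrite Ip relay_pulse//.
set c := relay_init p (I k).
have [->|ne] := eqVneq (pulse_state p (w k.+1) (pulse_state p (w k) c))
  (pulse_state p (w k) c).
  by rewrite subrr normr0 mulr0 !mulr_ge0.
have pS : strips a b M p.
  case/orP: (pulse_state_neq pP ne) => /andP[h1 h2]; [left|right];
    by split; rewrite //= in_itv/= /a /b ge_min le_max h1 h2 ?orbT.
rewrite indicE mem_set// mulr1 (mulrC 2) ler_pM// ?muK//.
apply: le_trans (ler_normB _ _) _.
have st1 := normr_pulse_state_le1 p (w k) (normr_relay_init_le1 p (I k)).
by have := normr_pulse_state_le1 p (w k.+1) st1; lra.
Qed.
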